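(* Let $G$ be a topological group acting continuously and freely (on the right) on a topological space $X$. Then the action is proper if and only if both of the following hold: (a) the quotient space $X/G$, with the quotient topology, is Hausdorff (equivalently, $X\times_G X$ is closed in $X\times X$); and (b) the translation map $\tau\colon X\times_G X\to G$ is continuous (equivalently, the canonical map $\gamma\colon X\times G\to X\times_G X$ is a homeomorphism).
   Context: No Hausdorff assumption is made on $G$ or $X$. An action of $G$ on $X$ is free if $x\cdot g=x$ for some $x\in X$ implies $g=e$. The orbit of $x$ is $\mathcal{O}_x=\{x\cdot g: g\in G\}$, and $X/G$ is the set of orbits with the quotient topology. Define $X\times_G X=\{(x,y)\in X\times X: \mathcal{O}_x=\mathcal{O}_y\}$ with the relative topology from $X\times X$. The canonical map is $\gamma\colon X\times G\to X\times_G X$, $(x,g)\mapsto(x,x\cdot g)$. For a free action, the translation map $\tau\colon X\times_G X\to G$ sends $(x,x\cdot g)$ to the unique such $g$. A map $f\colon Y\to Z$ of topological spaces is proper if it is continuous and $f\times 1_T\colon Y\times T\to Z\times T$ is a closed map for every topological space $T$. A continuous action is proper if $\widetilde\gamma\colon X\times G\to X\times X$, $(x,g)\mapsto(x,x\cdot g)$, is a proper map. *)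

(* Defs.v *)
From HB Require Import structures.
From mathcomp Require Import all_boot all_classical.
From mathcomp Require Import topology.

Set Implicit Arguments.
Unset Strict Implicit.
Unset Printing Implicit Defensive.

Local Open Scope classical_set_scope.

HB.mixin Record Topological_isTopologicalGroup G
    & Topological G & Group G := {
  mulg_continuous : continuous (fun p : G * G => (p.1 * p.2)%g) ;
  invg_continuous : continuous (fun g : G => g^-1%g)
}.

(* No separation axiom is included. *)
#[short(type="topologicalGroupType")]
HB.structure Definition TopologicalGroup :=
  {G of Topological G & Group G & Topological_isTopologicalGroup G}.

Definition closed_map (Y Z : topologicalType) (f : Y -> Z) : Prop :=
  forall A : set Y, closed A -> closed (f @` A).

Definition proper_map (Y Z : topologicalType) (f : Y -> Z) : Prop :=
  continuous f /\
  forall T : topologicalType, closed_map (fun p : Y * T => (f p.1, p.2)).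

Definition homeomorphism (Y Z : topologicalType) (f : Y -> Z) : Prop :=
  continuous f /\
  exists h : Z -> Y, [/\ cancel f h, cancel h f & continuous h].

Record right_action (G : groupType) (X : Type) := RightAction {
  right_act :> X -> G -> X ;
  right_act1 : forall x, right_act x 1%g = x ;
  right_actM : forall x g h, right_act x (g * h)%g = right_act (right_act x g) h
}.

Section Orbits.
Context {G : groupType} {X : Type} (act : right_action G X).

Definition free_action : Prop := forall x g, act x g = x -> g = 1%g.

Definition orbit (x : X) : set X := [set act x g | g in setT].

Definition orbit_rel (x y : X) : bool := `[< orbit x = orbit y >].

Lemma orbit_rel_refl : reflexive orbit_rel.
Proof. by move=> x; apply/asboolP. Qed.

Lemma orbit_rel_sym : symmetric orbit_rel.
Proof. by move=> x y; apply/asboolP/asboolP => ->. Qed.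

Lemma orbit_rel_trans : transitive orbit_rel.
Proof. by move=> y x z /asboolP xy /asboolP yz; apply/asboolP; rewrite xy. Qed.

(* The set X x_G X; as a type it carries the library's subtype topology, i.e.
   the initial topology of the inclusion into X * X. *)
Definition orbit_prod : set (X * X) := [set p | orbit p.1 = orbit p.2].

Lemma orbit_act x g : orbit x = orbit (act x g).
Proof.
apply/seteqP; split => y [h _ <-].
  by exists (g^-1 * h)%g => //; rewrite -right_actM mulgA mulgV mul1g.
by exists (g * h)%g => //; rewrite right_actM.
Qed.

Lemma orbit_prod_act (x : X) (g : G) : (x, act x g) \in orbit_prod.
Proof. by rewrite inE; exact: orbit_act. Qed.

Lemma orbit_prod_exists (p : orbit_prod) :
  exists g, act (val p).1 g = (val p).2.
Proof.
case: p => -[x y] /=; rewrite inE /orbit_prod /= => xy.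
have : orbit y y by exists 1%g => //; exact: right_act1.
by rewrite -xy => -[g _ <-]; exists g.
Qed.

(* The choice of [g] is arbitrary unless the action is free: see
   [translation_unique]. *)
Definition translation (p : orbit_prod) : G := sval (cid (orbit_prod_exists p)).

Lemma translationP (p : orbit_prod) : act (val p).1 (translation p) = (val p).2.
Proof. by rewrite /translation; case: cid. Qed.

Definition canonical_map (q : X * G) : orbit_prod :=
  exist _ (q.1, act q.1 q.2) (orbit_prod_act q.1 q.2).

Lemma translation_unique (p : orbit_prod) (g : G) :
  free_action -> act (val p).1 g = (val p).2 -> g = translation p.
Proof.
move=> fr; rewrite -translationP => e; apply: (mulIg (translation p)^-1%g).
by rewrite mulgV; apply: (fr (val p).1); rewrite right_actM e -right_actM mulgV
  right_act1.
Qed.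

End Orbits.

Arguments translation {G X} act p.

Section OrbitSpace.
Context {G : groupType} {X : topologicalType} (act : right_action G X).

Definition orbit_equiv : equiv_rel X :=
  EquivRel (orbit_rel act) (orbit_rel_refl act) (orbit_rel_sym act)
    (@orbit_rel_trans G X act).

Definition orbit_space : topologicalType :=
  quotient_topology {eq_quot orbit_equiv}%qT.

End OrbitSpace.

Section TopologicalActions.
Context {G : topologicalGroupType} {X : topologicalType}
  (act : right_action G X).

Definition continuous_action : Prop :=
  continuous (fun q : X * G => act q.1 q.2).

Definition proper_action : Prop :=
  continuous_action /\ proper_map (fun q : X * G => (q.1, act q.1 q.2)).

End TopologicalActions.

(* Main.v *)
Require Import Defs.
From mathcomp Require Import all_boot all_classical.
From mathcomp Require Import topology.

(* A proper map is closed, so properness makes X x_G X, the image of the action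
   graph (x, g) |-> (x, x g), closed, and makes tau continuous: the preimage of
   C under tau is the trace on X x_G X of the image of X * C.  Conversely, a
   limit point ((x, y), t) of the image of a closed set A of X * G * T has
   (x, y) in X x_G X, and continuity of tau puts ((x, tau (x, y)), t) in the
   closure of A.  The orbit space is Hausdorff exactly when X x_G X is closed
   because the quotient map is open. *)

Set Implicit Arguments.
Unset Strict Implicit.
Unset Printing Implicit Defensive.

Local Open Scope classical_set_scope.

Lemma continuous_pair (S T U : topologicalType) (f : S -> T) (g : S -> U) :
  continuous f -> continuous g -> continuous (fun x => (f x, g x)).
Proof.
move=> f_cont g_cont x.
by apply: (@cvg_pair _ _ _ _ (nbhs (f x)) (nbhs (g x)));
  [exact: f_cont|exact: g_cont].
Qed.

Lemma continuous_closed_preimage (S T : topologicalType) (f : S -> T)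
    (A : set T) :
  continuous f -> closed A -> closed (f @^-1` A).
Proof. by move=> /continuous_closedP; apply. Qed.

(** Testing properness on the space [bool] is enough: the image of [A] is the slice at [true] of the
    image of the closed cylinder over [A]. *)
Lemma proper_map_closed (Y Z : topologicalType) (f : Y -> Z) :
  proper_map f -> closed_map f.
Proof.
move=> [_ /(_ bool) clf] A cA.
have -> : f @` A = (fun z => (z, true)) @^-1`
    ((fun p : Y * bool => (f p.1, p.2)) @` (fst @^-1` A)).
  apply/seteqP; split => [_ [y Ay <-]|z /= [[y b] /= Ay [<- _]]].
    by exists (y, true).
  by exists y.
have pair_cont : continuous (fun z : Z => (z, true)).
  by apply: continuous_pair => z; [exact: cvg_id|exact: cst_continuous].
apply: (continuous_closed_preimage pair_cont (clf _ _)).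
by apply: (continuous_closed_preimage _ cA) => p; exact: cvg_fst.
Qed.

Lemma orbit_prodP (G : groupType) (X : Type) (act : right_action G X) x y :
  orbit_prod act (x, y) <-> exists g, act x g = y.
Proof.
split=> [/mem_set xy|[g <-]]; last exact: orbit_act.
exact: (orbit_prod_exists (exist _ (x, y) xy)).
Qed.

Section OrbitSpaceHausdorff.
Context {G : topologicalGroupType} {X : topologicalType}
  (act : right_action G X).
Hypothesis act_cont : continuous_action act.

Local Notation pi := (\pi_(orbit_space act)%qT : X -> orbit_space act).

Lemma orbit_piP x y : pi x = pi y <-> orbit_prod act (x, y).
Proof.
by split=> [/eqmodP/asboolP|xy]; last exact/eqmodP/asboolP.
Qed.

Lemma act_right_continuous g : continuous (act ^~ g).
Proof.
move=> x; apply: (@continuous_comp X (X * G)%type X (fun x => (x, g))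
  (fun q => act q.1 q.2)).
  by apply: continuous_pair => z; [exact: cvg_id|exact: cst_continuous].
exact: act_cont.
Qed.

(** The saturation of [U] is a union of translates of [U], each written as a preimage of [U] under
    the continuous map [act ^~ g]. *)
Lemma orbit_pi_open (U : set X) : open U -> open (pi @` U).
Proof.
move=> oU; rewrite /open /= /quotient_open.
have -> : pi @^-1` (pi @` U) = \bigcup_g (act ^~ g) @^-1` U.
  apply/seteqP; split=> [x [y Uy /esym/orbit_piP/orbit_prodP [g xgy]]|x [g _ Ug]].
    by exists g => //=; rewrite xgy.
  exists (act x g) => //; apply/esym/orbit_piP/orbit_prodP.
  by exists g.
apply: bigcup_open => g _; apply: open_comp => // x _.
exact: act_right_continuous.
Qed.

Lemma hausdorff_orbit_spaceP :
  hausdorff_space (orbit_space act) <-> closed (orbit_prod act).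
Proof.
split=> [hX|clX].
  (* [hausdorff_space] asks that points whose neighbourhoods always meet be equal, so it suffices
     that any neighbourhoods [A] and [B] of the two classes meet. *)
  move=> [x y] clxy; apply/orbit_piP/hX => A B /= Ax By.
  have [[x' y'] [/orbit_piP xy' [/= Ax' By']]] : orbit_prod act `&`
      ((pi @^-1` A) `*` (pi @^-1` B)) !=set0.
    apply: clxy; exists (pi @^-1` A, pi @^-1` B) => //.
    by split; exact: pi_continuous.
  by exists (pi x'); split=> //; rewrite xy'.
move=> p q; rewrite -[p]reprK -[q]reprK.
set x := repr p; set y := repr q => clpq.
apply/orbit_piP/clX => N [[U V] /= [Ux Vy] UVN].
move: Ux Vy; rewrite !nbhsE => -[U' [oU' U'x] U'U] [V' [oV' V'y] V'V].
(* Since [pi] is open, the images of [U'] and [V'] are neighbourhoods of the classes; a common point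
   of them lifts to a pair in [U' * V'] lying in one orbit. *)
have [||z [[x' U'x' <-] [y' V'y' /esym/orbit_piP xy']]] :=
    clpq (pi @` U') (pi @` V').
- by apply: open_nbhs_nbhs; split; [exact: orbit_pi_open|exists x].
- by apply: open_nbhs_nbhs; split; [exact: orbit_pi_open|exists y].
by exists (x', y'); split=> //; apply: UVN; split; [exact: U'U|exact: V'V].
Qed.

End OrbitSpaceHausdorff.

Section Translation.
Context {G : topologicalGroupType} {X : topologicalType}
  (act : right_action G X).
Hypotheses (act_cont : continuous_action act) (act_free : free_action act).

Local Notation tau := (translation act).

Lemma act_graph_continuous : continuous (fun q : X * G => (q.1, act q.1 q.2)).
Proof. by apply: continuous_pair => // q; exact: cvg_fst. Qed.

Lemma canonical_map_continuous : continuous (canonical_map act).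
Proof. by apply: continuous_comp_initial; exact: act_graph_continuous. Qed.

Lemma translation_canonical_map q : tau (canonical_map act q) = q.2.
Proof. by apply/esym/translation_unique. Qed.

Lemma canonical_map_translation (p : orbit_prod act) :
  canonical_map act ((val p).1, tau p) = p.
Proof. by apply: val_inj; rewrite /= translationP -surjective_pairing. Qed.

(** The inverse of the canonical map sends [p] to [((val p).1, tau p)]. Its first component is
    always continuous, and its second is [tau]. *)
Lemma continuous_translationP :
  continuous tau <-> homeomorphism (canonical_map act).
Proof.
split=> [tau_cont|[_ [h [_ hK h_cont]]]].
  split; first exact: canonical_map_continuous.
  exists (fun p => ((val p).1, tau p)); split.
  - by move=> [x g]; rewrite translation_canonical_map.
  - exact: canonical_map_translation.
  - apply: continuous_pair => // p.
    apply: (@continuous_comp _ (X * X)%type X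
      (val : orbit_prod act -> X * X) fst).
      exact: initial_continuous.
    exact: cvg_fst.
have -> : tau = snd \o h.
  by apply/funext => p; rewrite -{1}[p]hK translation_canonical_map.
move=> p; apply: continuous_comp; [exact: h_cont|exact: cvg_snd].
Qed.

Lemma proper_action_closed_orbit_prod :
  proper_action act -> closed (orbit_prod act).
Proof.
move=> [_ /proper_map_closed /(_ _ closedT)].
congr (closed _); apply/seteqP; split=> [_ [[x g] _ <-]|[x y]].
  exact: orbit_act.
by move=> /orbit_prodP [g <-]; exists (x, g).
Qed.

Lemma proper_action_translation_continuous :
  proper_action act -> continuous tau.
Proof.
move=> [_ /proper_map_closed cl_act]; apply/continuous_closedP => C cC.
have -> : tau @^-1` C = val @^-1`
    ((fun q : X * G => (q.1, act q.1 q.2)) @` (snd @^-1` C)).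
  apply/seteqP; split=> [p Cp|p /= [[x g] Cg xg]].
    exists ((val p).1, tau p) => //=.
    by rewrite translationP -surjective_pairing.
  (* Freeness forces [g = tau p]. *)
  by rewrite -(translation_unique (g := g)) // -[val p]xg.
apply: (continuous_closed_preimage _ (cl_act _ _)).
  exact: initial_continuous.
by apply: (continuous_closed_preimage _ cC) => q; exact: cvg_snd.
Qed.

Lemma closed_orbit_prod_proper_action :
  closed (orbit_prod act) -> continuous tau -> proper_action act.
Proof.
move=> clX tau_cont; split=> //; split; first exact: act_graph_continuous.
move=> T A cA [[x y] t] cl_xyt.
have xy : (x, y) \in orbit_prod act.
  (* Forgetting the coordinate in [T] makes [(x, y)] a limit point of [orbit_prod act]. *)
  apply/mem_set/clX => N Nxy.
  have [_ [[[[x' g] t'] _ <-] /= Nx']] := cl_xyt (fst @^-1` N) (cvg_fst Nxy).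
  by exists (x', act x' g); split=> //; exact: orbit_act.
pose p : orbit_prod act := exist _ (x, y) xy.
exists ((x, tau p), t); last by rewrite /= (translationP p).
apply: cA => B [[B1 V] /= [[[U W] /= [Ux Wg] UW] Vt] UWV].
(* By the subspace topology, [N] is an open set of [X * X] whose trace on [orbit_prod act] is sent
   into [W] by [tau]. *)
have [_ [[N oN <-] /= Nxy NW]] := tau_cont p W Wg.
(* [N] controls only the group element; the factor [U] keeps the base point near [x]. *)
have nbhs_xyt : nbhs ((x, y), t) ((N `&` (U `*` setT)) `*` V).
  exists (N `&` (U `*` setT), V) => //; split=> //.
  apply: filterI; first exact: open_nbhs_nbhs.
  by exists (U, setT) => //; split=> //; exact: filterT.
have [_ [[[[x' g] t'] Axgt <-] [[/= Nx' [Ux' _]] Vt']]] := cl_xyt _ nbhs_xyt.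
exists ((x', g), t'); split=> //; apply/UWV; split=> //; apply: UW; split=> //=.
by have /= := NW (canonical_map act (x', g)) Nx'; rewrite translation_canonical_map.
Qed.

End Translation.

Theorem lemma2p6 (G : topologicalGroupType) (X : topologicalType)
    (act : right_action G X)
    (act_cont : continuous_action act) (act_free : free_action act) :
  [/\ proper_action act <->
        hausdorff_space (orbit_space act) /\ continuous (translation act),
      hausdorff_space (orbit_space act) <-> closed (orbit_prod act) &
      continuous (translation act) <-> homeomorphism (canonical_map act)].
Proof.
have hausP := hausdorff_orbit_spaceP act_cont.
split; [split | exact: hausP | exact: continuous_translationP].
  move=> proper; split; last exact: proper_action_translation_continuous.
  exact/hausP/proper_action_closed_orbit_prod.
by move=> [/hausP clX tau_cont]; exact: closed_orbit_prod_proper_action.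
Qed.
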